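(* Let $d$ be a positive real number and let $G$ be a graph such that $\lVert H\rVert\leq d|H|$ for every subgraph $H$ of $G$ (in particular for every bipartite subgraph). If $\Delta(G)\geq 6.21d$, then $G$ has an equitable $r$-coloring for every integer $r\geq \Delta(G)$.
   Context: All graphs are finite and simple. For a graph $H$, $|H|$ denotes its number of vertices and $\lVert H\rVert$ its number of edges; $\Delta(G)$ is the maximum degree. (This class is denoted $\mathcal{G}_d$ in the paper.) An equitable $r$-coloring of a graph is a partition of its vertex set into $r$ independent sets $V_1,\dots,V_r$ (some possibly empty) with $\big||V_i|-|V_j|\big|\leq 1$ for all $i,j$. *)

(* Defs.v *)
From mathcomp Require Import all_boot all_order all_algebra.
From mathcomp Require Import reals.
Set Implicit Arguments. Unset Strict Implicit. Unset Printing Implicit Defensive.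
Import Order.TTheory GRing.Theory Num.Theory.

Definition simple_graph (T : finType) (e : rel T) : Prop :=
  symmetric e /\ irreflexive e.

Definition edges (T : finType) (e : rel T) : {set {set T}} :=
  [set [set x; y] | x in T, y in T & e x y].

(* A subgraph H = (S, F) of G: S a set of vertices, F a set of edges of G
   with both endpoints in S.  |H| = #|S|, ||H|| = #|F|. *)
Definition is_subgraph (T : finType) (e : rel T) (S : {set T}) (F : {set {set T}}) : Prop :=
  F \subset edges e /\ (forall f, f \in F -> f \subset S).

Definition deg (T : finType) (e : rel T) (v : T) : nat := #|[set u | e v u]|.
Definition maxdeg (T : finType) (e : rel T) : nat := \max_(v : T) deg e v.

Definition equitable_coloring (T : finType) (e : rel T) (r : nat) (c : T -> 'I_r) : Prop :=
  (forall x y, e x y -> c x != c y) /\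
  (forall i j : 'I_r, #|[set x | c x == i]| <= #|[set x | c x == j]|.+1)%N.

(* Main.v *)
Require Import Defs.
From mathcomp Require Import all_boot all_order all_algebra.
From mathcomp Require Import reals zify lra.
Import Order.TTheory GRing.Theory Num.Theory.
Set Implicit Arguments. Unset Strict Implicit. Unset Printing Implicit Defensive.

(** Colour the vertices one at a time, adding a vertex [x] of degree at most [2d] to an
    equitable colouring [f] of the rest.  Call a colour class movable to another one if
    one of its vertices has no neighbour there, and let [A] be the set of classes from
    which a smallest class is reachable by such moves; take [f] with [A] as large as
    possible.  If [x] has no neighbour in some class of [A], shifting vertices along a
    path of moves makes room for it, so [A] has at most [2d] classes.

    Two classes that are not movable to each other in both directions span at least a
    class-size number of edges.  Hence, by sparsity, a set of [p] large classes that is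
    a union of strong components of the move relation satisfies [p (r - p) < d r], so
    [p] is below [0.202 r] or above [0.798 r]; this forces a strong component [P]
    outside [A] with more than [0.798 r] classes, and [x] can enter [P].

    Let [W] be a class of [A] farthest from the small classes.  Every vertex of [P] has
    a neighbour in [W]; counting these edges gives [z] in [W] that is the only
    neighbour in [W] of a set [S] of almost [p] vertices of [P].  If [z] can move inside
    [A], push [x] into [P], a vertex of [S] into [W] and [z] into [A].  Otherwise, if [y],
    [y'] in [S] are not adjacent and [z] can take the place of [y], exchanging [z] and
    [y] lets [y'] move to [W], which enlarges [A].  So many vertices of [S] are adjacent
    to all of [S], too many for the sparsity of the graph. *)

(** * Numerical inequalities *)

(* [101/500] and [399/500] bracket the roots of [t * (1 - t) = 100/621]. *)
Lemma gap_arith z x : 621 * (z * x) < 100 * ((z + x) * (z + x)) ->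
  (500 * z < 101 * (z + x)) || (399 * (z + x) < 500 * z).
Proof.
move=> main; case: ltnP => //= h1; case: ltnP => //= h2; exfalso.
have [a aE] : exists a, 500 * z = 101 * (z + x) + a.
  by exists (500 * z - 101 * (z + x)); lia.
have [b bE] : exists b, 500 * x = 101 * (z + x) + b.
  by exists (500 * x - 101 * (z + x)); lia.
have abE : a + b = 298 * (z + x) by lia.
(* As [a + b] is [298 * (z + x)] and [a * b] is nonnegative, [250000 * z * x] is at least
   [101 * 399] times the square of [z + x], while [621 * 101 * 399 > 100 * 250000]. *)
have : (500 * z) * (500 * x) =
    101 * (101 * ((z + x) * (z + x))) + (z + x) * (101 * (a + b)) + a * b.
  by rewrite aE bE; move: (z + x) => t; nia.
rewrite abE mulnACA [(z + x) * (_ * _)]mulnCA [(z + x) * (_ * _)]mulnCA -mulnA.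
move: main {h1 h2 aE bE abE}.
by move: (z * x) ((z + x) * (z + x)) (a * b) => u v w; lia.
Qed.

(** Here [m] is the number of classes outside [P]. For [Q <= S] the left side of the last inequality
    grows with [Q], and at [Q = k] its excess over the right side grows with [S]. Lowering [Q] to
    [k] and [S] to [r - m - 1] leaves a quadratic inequality in [r] and [m]. *)
Lemma clique_arith_int (r m k S Q : int) :
  (1 <= m -> 500 * m < 101 * r -> k = r - 3 * m -> k <= Q -> Q <= S ->
   r - m - 1 <= S -> 621 * (Q * (2 * S - Q - 1)) <= 200 * r * S -> False)%R.
Proof.
move=> m1 mr kE kQ QS Sm main.
have r5 : (5 <= r)%R by lia.
have atk : (621 * (k * (2 * S - k - 1)) <= 200 * r * S)%R.
  have : (0 <= (Q - k) * (2 * S - 1 - Q - k))%R.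
    have [->|le] : (Q = k \/ Q + k <= 2 * S - 1)%R by lia.
      by lia.
    by apply: mulr_ge0; lia.
  by lia.
have h2 : (0 <= (1242 * k - 200 * r) * (S - (r - m - 1)))%R.
  by apply: mulr_ge0; lia.
have h3 : (0 <= (m - 1) * (101 * r - 500 * m))%R by apply: mulr_ge0; lia.
have h4 : (621 * (k * (2 * (r - m - 1) - k - 1)) <= 200 * r * (r - m - 1))%R by lia.
have h5 : (0 <= (r - 5) * (101 * r - 500 * m))%R by apply: mulr_ge0; lia.
have h6 : (0 <= (r - 5) * (m - 1))%R by apply: mulr_ge0; lia.
have h7 : (0 <= (r - 5) * (r - 5))%R by apply: mulr_ge0; lia.
rewrite {}kE in h4; clear -m1 mr r5 h3 h4 h5 h6 h7; nia.
Qed.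

Lemma clique_arith r p S Q : 399 * r < 500 * p -> p < r -> 3 * p <= Q + 2 * r ->
    Q <= S -> p <= S.+1 -> 621 * (Q * S.-1 + (S - Q) * Q) <= 200 * r * S -> False.
Proof.
move=> p1 p2 Q1 QS S1; case: S QS S1 => [|S] QS S1 /=; first by lia.
have [D DE] : exists D, S.+1 = Q + D by exists (S.+1 - Q); lia.
rewrite [in _ - Q]DE addKn => main.
apply: (@clique_arith_int r%:Z (r%:Z - p%:Z) (3 * p%:Z - 2 * r%:Z) S.+1%:Z Q%:Z); lia.
Qed.

(** * Reachability and strong components in a finite digraph *)

Section Digraph.
Context (C : finType) (R : rel C).
Implicit Types (S B Z P : {set C}) (i j : C).

Definition coreach S := [set i | [exists j in S, connect R i j]].

Lemma coreachP S i : reflect (exists2 j, j \in S & connect R i j) (i \in coreach S).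
Proof. by rewrite inE; apply: exists_inP. Qed.

Lemma sub_coreach S : S \subset coreach S.
Proof. by apply/subsetP => i iS; apply/coreachP; exists i. Qed.

Lemma coreach_step S i j : R i j -> j \in coreach S -> i \in coreach S.
Proof.
move=> Rij /coreachP[k kS ck]; apply/coreachP; exists k => //.
exact: connect_trans (connect1 Rij) ck.
Qed.

Lemma coreachC_connect S i j : i \notin coreach S -> connect R i j -> j \notin coreach S.
Proof.
move=> iS cij; apply: contraNN iS => /coreachP[k kS cjk].
by apply/coreachP; exists k => //; apply: connect_trans cij cjk.
Qed.

(** Breadth-first search towards [S]. The layers are cumulative, so the least [n] whose layer is
    everything measures the largest distance. *)
Fixpoint layer S n :=
  if n is n'.+1 then layer S n' :|: [set i | [exists j in layer S n', R i j]] else S.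

Lemma layer_sub S n : layer S n \subset coreach S.
Proof.
elim: n => [|n IHn] /=; first exact: sub_coreach.
rewrite subUset IHn; apply/subsetP => i; rewrite inE => /exists_inP[j jn Rij].
exact: coreach_step Rij (subsetP IHn _ jn).
Qed.

Lemma layer_mono S m n : m <= n -> layer S m \subset layer S n.
Proof.
elim: n => [|n IHn]; first by rewrite leqn0 => /eqP ->.
rewrite leq_eqVlt => /orP[/eqP -> //|/IHn sub].
exact: subset_trans sub (subsetUl _ _).
Qed.

Lemma coreach_layer S : exists n, coreach S \subset layer S n.
Proof.
exists #|C|; apply/subsetP => i /coreachP[j jS /connectP[p0 pp0 jE]].
case: (shortenP pp0) jE => p pp up _ jE {p0 pp0}.
have : i \in layer S (size p).
  elim: p i pp jE {up} => [|k p IHp] i /= pp jE; first by rewrite -jE.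
  case/andP: pp => Rik pp; rewrite !inE; apply/orP; right.
  by apply/exists_inP; exists k => //; apply: IHp.
apply/subsetP/layer_mono; rewrite -ltnS; apply: leqW.
by rewrite -[(size p).+1]/(size (i :: p)) -(card_uniqP up) max_card.
Qed.

(* [W] is chosen at maximal distance from [S]. *)
Lemma exists_terminal S : S != set0 ->
  exists W, [/\ W \in coreach S,
    W \in S \/ exists2 k, k \in coreach S :\ W & R W k
    & forall i, i \in coreach S :\ W -> exists2 j, j \in S :\ W &
        connect [rel a b | [&& a \in coreach S :\ W, b \in coreach S :\ W & R a b]] i j].
Proof.
move=> S0; set A := coreach S.
have ex : exists n, A \subset layer S n by apply: coreach_layer.
case: (ex_minnP ex) => -[|n] /= Asub minn.
  have /set0Pn[W WS] := S0; exists W; split; [exact: (subsetP (sub_coreach S))|by left|].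
  move=> i /setD1P[iW iA]; exists i => //.
  by rewrite !inE iW (subsetP Asub).
have /subsetPn[W WA Wn] : ~~ (A \subset layer S n).
  by apply/negP => /minn; rewrite ltnn.
have nW i : i \in layer S n -> i \in A :\ W.
  move=> iin; rewrite in_setD1 (subsetP (layer_sub S n)) // andbT.
  by apply: contraNneq Wn => <-.
(* Paths descending through the layers stay in [layer S n], which misses [W], so deleting [W] cuts
   nothing off from [S]. *)
have reach m i : m <= n -> i \in layer S m -> exists2 j, j \in S :\ W &
    connect [rel a b | [&& a \in A :\ W, b \in A :\ W & R a b]] i j.
  elim: m i => [|m IHm] i mn /=.
    move=> iS; exists i => //; rewrite in_setD1 iS andbT.
    by have /setD1P[] := nW i (subsetP (layer_mono S mn) i iS).
  rewrite inE => /orP[|]; first by apply: IHm; apply: ltnW.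
  rewrite inE => /exists_inP[k km Rik].
  have [j jS ckj] := IHm k (ltnW mn) km; exists j => //.
  apply: connect_trans (connect1 _) ckj; rewrite /= Rik andbT.
  rewrite !nW //; first exact: (subsetP (layer_mono S (ltnW mn))).
  apply: (subsetP (layer_mono S mn)); rewrite /= !inE; apply/orP; right.
  by apply/exists_inP; exists k.
exists W; split=> //.
  right; move: (subsetP Asub _ WA); rewrite inE (negbTE Wn) inE /=.
  by move=> /exists_inP[k kn RWk]; exists k => //; apply: nW.
move=> i iAW; have [iW iA] := setD1P iAW.
move: (subsetP Asub _ iA); rewrite inE => /orP[|]; first exact: reach.
rewrite inE => /exists_inP[k kn Rik].
have [j jS ckj] := reach n k (leqnn n) kn; exists j => //.
by apply: connect_trans (connect1 _) ckj; rewrite /= Rik iAW nW.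
Qed.

(* The second hypothesis says that no union of strong components has an intermediate
   size, so removing components from [B] one at a time must meet a large one. *)
Lemma exists_large_component B :
    (forall i j, i \in B -> connect R i j -> j \in B) ->
    (forall Z, Z \subset B ->
       (forall i j, i \in Z -> j \notin Z -> R i j -> R j i -> False) ->
       (500 * #|Z| < 101 * #|C|) || (399 * #|C| < 500 * #|Z|)) ->
    399 * #|C| < 500 * #|B| ->
  exists P, [/\ P \subset B, 399 * #|C| < 500 * #|P|,
    forall i j, i \in P -> j \in P -> connect R i j
    & forall i j, i \in P -> j \notin P -> R i j -> R j i -> False].
Proof.
move=> closedB gap largeB.
(* These are the large unions of strong components; the component [P] is taken inside a smallest
   one. *)
pose sat Z := [&& Z \subset B, 399 * #|C| < 500 * #|Z| &
  [forall i in Z, forall j, (connect R i j && connect R j i) ==> (j \in Z)]].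
have satB : sat B.
  rewrite /sat subxx largeB /=; apply/forall_inP => i iB; apply/forallP => j.
  by apply/implyP => /andP[cij _]; apply: closedB cij.
case: (arg_minnP (fun Z : {set C} => #|Z|) satB) => Z /and3P[ZB largeZ].
move=> /forall_inP satZ minZ.
have satP i j : i \in Z -> connect R i j -> connect R j i -> j \in Z.
  by move=> iZ cij cji; move/forallP: (satZ i iZ) => /(_ j); rewrite cij cji.
have [i iZ] : exists i, i \in Z by apply/set0Pn; rewrite -card_gt0; lia.
pose P := [set j | connect R i j && connect R j i].
have PZ : P \subset Z.
  by apply/subsetP => j; rewrite inE => /andP[cij cji]; apply: satP cij cji.
have iP : i \in P by rewrite inE connect0.
have satPP k j : k \in P -> connect R k j -> connect R j k -> j \in P.
  rewrite !inE => /andP[cik cki] ckj cjk.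
  by rewrite (connect_trans cik ckj) (connect_trans cjk cki).
have sepP k j : k \in P -> j \notin P -> R k j -> R j k -> False.
  move=> kP jP Rkj Rjk; move/negP: jP; apply.
  by apply: satPP kP _ _; apply: connect1.
exists P; split=> //; first exact: subset_trans PZ ZB; last first.
  move=> j k; rewrite !inE => /andP[_ cji] /andP[cik _].
  exact: connect_trans cji cik.
have /orP[smallP|//] := gap P (subset_trans PZ ZB) sepP.
have ZDP : Z :\: P \subset B := subset_trans (subsetDl _ _) ZB.
have satD k j : k \in Z :\: P -> connect R k j -> connect R j k -> j \in Z :\: P.
  rewrite !inE => /andP[kP kZ] ckj cjk; rewrite (satP k) // andbT.
  by apply: contraNN kP => jP; have := satPP j k; rewrite !inE; apply.
have cardZ : #|Z| = #|P| + #|Z :\: P|.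
  by rewrite -(cardsID P Z) (setIidPr PZ).
(* If [P] is small, then the rest of [Z] is either small, though two small sets cannot make up [Z],
   or large, against minimality. *)
have /orP[smallD|largeD] : (500 * #|Z :\: P| < 101 * #|C|) ||
    (399 * #|C| < 500 * #|Z :\: P|).
- apply: gap => // k j kD jD Rkj Rjk; move/negP: jD; apply.
  by apply: satD kD _ _; apply: connect1.
- by exfalso; lia.
- have : sat (Z :\: P).
    rewrite /sat ZDP largeD /=; apply/forall_inP => k kD; apply/forallP => j.
    by apply/implyP => /andP[ckj cjk]; apply: satD ckj cjk.
  move=> /minZ; have : 0 < #|P| by apply/card_gt0P; exists i.
  lia.
Qed.

End Digraph.

(** * Partial colourings, moves and exchanges of vertices *)

Section Recoloring.
Context (T C : finType) (e : rel T).
Hypotheses (e_sym : symmetric e) (e_irr : irreflexive e).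
Implicit Types (V : {set T}) (f : T -> C) (h v : T) (i j : C).

(** Colourings are total functions read only on [V], the vertices coloured so far; uncolouring a
    vertex means deleting it from [V]. *)
Definition color_class V f i := [set v in V | f v == i].

Definition proper V f := {in V &, forall u v, e u v -> f u != f v}.

Definition free V f v i := [forall u in V, (f u == i) ==> ~~ e v u].

Definition movable V f i j := [exists v in V, (f v == i) && free V f v j].

Definition recolor f h i := fun v => if v == h then i else f v.

Lemma freeP V f v i :
  reflect (forall u, u \in V -> f u = i -> e v u = false) (free V f v i).
Proof.
apply: (iffP forall_inP) => [fr u uV fu | fr u uV].
  by apply/negbTE; move: (fr u uV); rewrite fu eqxx.
by apply/implyP => /eqP fu; rewrite (fr u).
Qed.

Lemma movableP V f i j :
  reflect (exists2 v, v \in V /\ f v = i & free V f v j) (movable V f i j).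
Proof.
apply: (iffP exists_inP) => [[v vV /andP[/eqP fv fr]]|[v [vV fv] fr]].
  by exists v.
by exists v; rewrite ?fv ?eqxx.
Qed.

Lemma recolor_proper V f h i : proper V f -> h \notin V -> free V f h i ->
  proper (h |: V) (recolor f h i).
Proof.
move=> pf hV /freeP fr u v; rewrite !inE /recolor.
case: eqP => [->|_] /= uV; case: eqP => [->|_] //= vV.
- by rewrite e_irr.
- by move=> euv; apply/eqP => fv; rewrite (fr v) in euv.
- by rewrite e_sym => euv; apply/eqP => fv; rewrite (fr u) in euv.
- exact: pf.
Qed.

Lemma recolor_card V f h i k : h \notin V ->
  #|color_class (h |: V) (recolor f h i) k| = #|color_class V f k| + (k == i).
Proof.
move=> hV; case: (eqVneq k i) => [->|ki].
  have -> : color_class (h |: V) (recolor f h i) i = h |: color_class V f i.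
    apply/setP => v; rewrite !inE /recolor; case: (eqVneq v h) => //= _.
    by rewrite eqxx.
  by rewrite cardsU1 inE (negbTE hV) addnC.
rewrite addn0; apply: eq_card => v; rewrite !inE /recolor.
case: (eqVneq v h) => [->|//]; rewrite (negbTE hV) /=.
by rewrite eq_sym (negbTE ki).
Qed.

Lemma proper_sub (V' V : {set T}) f : V' \subset V -> proper V f -> proper V' f.
Proof. by move=> /subsetP sub pf u v uV vV; apply: pf; apply: sub. Qed.

Lemma color_class_del V f v k : v \in V ->
  #|color_class V f k| = #|color_class (V :\ v) f k| + (k == f v).
Proof.
move=> vV; rewrite [#|color_class V f k|](cardsD1 v) inE vV /= addnC eq_sym.
by congr (_ + _); apply: eq_card => u; rewrite !inE andbA.
Qed.

Lemma replace_vertex V f h v : proper V f -> h \notin V -> v \in V ->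
    (forall u, u \in V -> f u = f v -> e h u -> u = v) ->
  proper (h |: V :\ v) (recolor f h (f v)) /\
  forall k, #|color_class (h |: V :\ v) (recolor f h (f v)) k|
            = #|color_class V f k|.
Proof.
move=> pf hV vV only; have hV' : h \notin V :\ v.
  by rewrite inE (negbTE hV) andbF.
split.
  apply: recolor_proper => //; first exact: proper_sub (subD1set _ _) pf.
  apply/freeP => u; rewrite !inE => /andP[uv uV] fu.
  by apply/negbTE/negP => /(only u uV fu) /eqP; rewrite (negbTE uv).
by move=> k; rewrite recolor_card // (color_class_del _ _ vV).
Qed.

(* [h] enters class [j], which gives up a vertex to the next class of the path, and so
   on until [y] is left over. *)
Lemma slide V f h y j (p : seq C) :
    proper V f -> h \notin V -> y \in V ->
    uniq (j :: p) -> path (movable V f) j p -> last j p = f y ->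
    (forall u, u \in V -> f u = j -> e h u -> u = y) ->
  exists g, [/\ proper (h |: V :\ y) g,
    forall k, #|color_class (h |: V :\ y) g k| = #|color_class V f k|,
    g h \in j :: p
    & forall v, v \in V :\ y ->
        if f v \in j :: p then g v \in j :: p else g v == f v].
Proof.
elim: p V f h j => [|k p IHp] V f h j pf hV yV.
  move=> _ _ /= -> only.
  have [pg cg] := replace_vertex pf hV yV only.
  exists (recolor f h (f y)); split=> //.
    by rewrite /recolor eqxx mem_head.
  move=> v /setD1P[_ vV]; rewrite /recolor; case: eqP => [vh|_].
    by rewrite -vh vV in hV.
  by rewrite eqxx; case: ifP.
rewrite [uniq _]/= => /andP[jkp ukp] /= /andP[/movableP[v [vV fv] /freeP frv] pkp].
move=> lst only.
have fyj : f y != j.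
  by apply/eqP => fyj; move: jkp; rewrite -fyj -lst mem_last.
have yv : y != v by apply: contraNneq fyj => ->; rewrite fv.
have yh : y != h by apply: contraNneq hV => <-.
have vh : v != h by apply: contraNneq hV => <-.
(* Since [y] lies outside class [j], the hypothesis on [h] now says that [h] has no neighbour in [j]
   at all. *)
have only' u : u \in V -> f u = f v -> e h u -> u = v.
  rewrite fv => uV fu ehu; move: (only u uV fu ehu) fyj => <-.
  by rewrite fu eqxx.
have [pg cg] := replace_vertex pf hV vV only'.
set V1 := h |: V :\ v in pg cg; set f1 := recolor f h (f v) in pg cg.
have f1E u : u != h -> f1 u = f u by rewrite /f1 /recolor => /negbTE ->.
have f1h : f1 h = j by rewrite /f1 /recolor eqxx fv.
have vV1 : v \notin V1 by rewrite !inE eqxx (negbTE vh).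
have yV1 : y \in V1 by rewrite !inE yv yV orbT.
have inV1 u : u \in V1 -> f1 u != j -> [/\ u \in V, u != h & f u = f1 u].
  rewrite !inE; case: (eqVneq u h) => [->|uh] /=; first by rewrite f1h eqxx.
  by move=> /andP[_ uV]; rewrite f1E.
(* The rest of the path avoids [j], the only class that has changed. *)
have pkp1 : path (movable V1 f1) k p.
  apply: (@sub_in_path _ (predC1 j) (movable V f)) pkp => [a b|]; last first.
    by apply/allP => a akp; apply: contraNneq jkp => <-.
  rewrite !inE => aj bj /movableP[w [wV fw] /freeP frw].
  have wh : w != h by apply: contraNneq hV => <-.
  have wv : w != v by apply: contraNneq aj => wv; rewrite -fw wv fv.
  apply/movableP; exists w; first by rewrite !inE wv wV orbT f1E.
  apply/freeP => u uV1 f1u; have [|uV _ fu] := inV1 u uV1; first by rewrite f1u.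
  by apply: frw; rewrite ?fu.
have only1 u : u \in V1 -> f1 u = k -> e v u -> u = y.
  move=> uV1 f1u; have [|uV _ fu] := inV1 u uV1.
    by rewrite f1u; apply: contraNneq jkp => <-; rewrite mem_head.
  by rewrite frv // fu.
have lst1 : last k p = f1 y by rewrite f1E.
have [g [pg' cg' gv gV]] := IHp V1 f1 v k pg vV1 yV1 ukp pkp1 lst1 only1.
have eqV : v |: V1 :\ y = h |: V :\ y.
  apply/setP => u; rewrite !inE; case: (eqVneq u v) => [->|uv] /=.
    by rewrite vV [v == y]eq_sym yv orbT.
  by case: (eqVneq u h) => [->|//]; rewrite [h == y]eq_sym yh.
rewrite eqV in pg' cg'; exists g; split=> //.
- by move=> l; rewrite cg' cg.
- have hV1 : h \in V1 :\ y by rewrite !inE eqxx [h == y]eq_sym yh.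
  move: (gV h hV1); rewrite f1h; case: ifP => [jin|_ /eqP ->].
    by rewrite jin in jkp.
  by rewrite mem_head.
- move=> u /setD1P[uy uV].
  have uh : u != h by apply: contraNneq hV => <-.
  case: (eqVneq u v) => [->|uv]; first by rewrite fv mem_head in_cons gv orbT.
  have uV1 : u \in V1 :\ y by rewrite !inE uy uv uV orbT.
  move: (gV u uV1); rewrite f1E // !(in_cons j).
  case: (boolP (f u \in k :: p)) => [fin gin|_ /eqP ->].
    by rewrite orbT gin orbT.
  by rewrite orbF; case: ifP => // ->.
Qed.

(** Stopping [slide] one class before the end leaves over a vertex free for the last class [i],
    which absorbs it and is the only class to grow. On a trivial path [h] enters directly. *)
Lemma shift_into V f h j i : proper V f -> h \notin V -> free V f h j ->
    connect (movable V f) j i ->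
  exists2 g, proper (h |: V) g &
    forall k, #|color_class (h |: V) g k| = #|color_class V f k| + (k == i).
Proof.
move=> pf hV frh /connectP[p0 pp0 ->].
case: (shortenP pp0) => p pp up _ {p0 pp0}.
case: (lastP p) pp up => [|p' k] pp up /=.
  exists (recolor f h j); first exact: recolor_proper.
  by move=> k; apply: recolor_card.
rewrite last_rcons; move: pp up.
rewrite rcons_path -rcons_cons rcons_uniq => /andP[pp' mv] /andP[knp up].
have /movableP[v [vV fv] /freeP frv] := mv.
have only u : u \in V -> f u = j -> e h u -> u = v.
  by move=> uV fu; move/freeP: frh => ->.
have [g [pg cg gh gV]] := slide pf hV vV up pp' (esym fv) only.
have vh : v != h by apply: contraNneq hV => <-.
have vV' : v \notin h |: V :\ v by rewrite !inE eqxx (negbTE vh).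
have frv' : free (h |: V :\ v) g v k.
  apply/freeP => u; rewrite !inE; case: (eqVneq u h) => [->|uh] /=.
    by move=> _ ghk; rewrite -ghk gh in knp.
  move=> uV gu; have := gV u; rewrite !inE => /(_ uV).
  case: ifP => _; rewrite -?in_cons gu; first by move=> kp; rewrite kp in knp.
  by move=> /eqP fu; apply: frv => //; case/andP: uV.
have eqV : v |: (h |: V :\ v) = h |: V.
  apply/setP => u; rewrite !inE; case: (eqVneq u v) => [->|//].
  by rewrite vV orbT.
exists (recolor g v k); first by rewrite -eqV; apply: recolor_proper.
by move=> l; rewrite -eqV recolor_card // cg.
Qed.

(* [h] slides through the complement of [A] to [y], which replaces [z]; the case [h = z]
   is a permutation of the vertices of [V]. *)
Lemma rotate V f (A : {set C}) z h y j :
    proper V f -> (forall i k, i \notin A -> movable V f i k -> k \notin A) ->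
    z \in V -> f z \in A -> y \in V -> f y \notin A ->
    (forall u, u \in V -> f u = f z -> e y u -> u = z) ->
    h \notin V :\ z -> j \notin A ->
    (forall u, u \in V -> f u = j -> e h u -> u = y) ->
    connect (movable V f) j (f y) ->
  exists g, [/\ proper (h |: V :\ z) g,
    forall k, #|color_class (h |: V :\ z) g k| = #|color_class V f k|,
    g y = f z,
    forall u, u \in V :\ z -> f u \in A -> g u = f u
    & forall u, u \in h |: V :\ z -> u != y -> g u \in A ->
        u \in V :\ z /\ f u = g u].
Proof.
move=> pf closed zV zA yV yA solo hV jA only /connectP[p0 pp0 lst0].
case: (shortenP pp0) lst0 => p pp up _ lst {p0 pp0}.
have pA : {in j :: p, forall i, i \notin A}.
  elim: p {up lst only} j jA pp => [|k p IHp] j jA /=.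
    by move=> _ i; rewrite inE => /eqP ->.
  move=> /andP[mv pp] i; rewrite inE => /orP[/eqP -> //|].
  by apply: IHp pp i; apply: closed mv.
have yz : y != z by apply: contraNneq yA => ->.
have yV' : y \in V :\ z by rewrite !inE yz.
have yh : y != h by apply: contraNneq hV => <-.
(* The class of [z] is in [A], so deleting [z] does not disturb moves between classes outside
   [A]. *)
have pp' : path (movable (V :\ z) f) j p.
  apply: (@sub_in_path _ (predC (mem A)) (movable V f)) pp => [a b|]; last first.
    by apply/allP => a /pA.
  rewrite !inE => aA bA /movableP[w [wV fw] /freeP frw].
  have wz : w != z by apply: contraNneq aA => wz; rewrite -fw wz.
  apply/movableP; exists w; first by rewrite !inE wz.
  by apply/freeP => u /setD1P[_ uV]; apply: frw.
have only' u : u \in V :\ z -> f u = j -> e h u -> u = y.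
  by move=> /setD1P[_]; apply: only.
have [g [pg cg gh gV]] :=
  slide (proper_sub (subD1set _ _) pf) hV yV' up pp' (esym lst) only'.
set V1 := h |: V :\ z :\ y in pg cg.
have yV1 : y \notin V1 by rewrite !inE eqxx (negbTE yh).
have V1A u : u \in V1 -> g u \in A -> u \in V :\ z :\ y /\ f u = g u.
  rewrite in_setU1 => /orP[/eqP ->|uV] guA; first by rewrite (negbTE (pA _ gh)) in guA.
  split=> //; move: (gV u uV); case: ifP => _; last by move/eqP.
  by move=> /pA; rewrite guA.
(* The slide brings nothing into the classes of [A], and [z], the only possible neighbour of [y] in
   its class, is gone. *)
have fry : free V1 g y (f z).
  apply/freeP => u uV1 gu; have [|uV fu] := V1A u uV1; first by rewrite gu.
  move: uV; rewrite !inE => /and3P[_ uz uV].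
  apply/negbTE/negP => eyu; move: uz; rewrite (solo u) ?eqxx //.
  by rewrite fu.
have eqV : y |: V1 = h |: V :\ z.
  apply/setP => u; rewrite !inE; case: (eqVneq u y) => [->|//].
  by rewrite yz yV !orbT.
exists (recolor g y (f z)); rewrite -eqV; split.
- exact: recolor_proper.
- by move=> k; rewrite recolor_card // cg (color_class_del f k zV).
- by rewrite /recolor eqxx.
- move=> u uV fu; have uy : u != y by apply: contraNneq yA => <-.
  rewrite /recolor (negbTE uy); have uV' : u \in V :\ z :\ y by rewrite in_setD1 uy.
  by move: (gV u uV'); case: ifP => [/pA|_ /eqP //]; rewrite fu.
- move=> u uV uy; rewrite /recolor (negbTE uy) => guA.
  have uV1 : u \in V1 by move: uV; rewrite in_setU1 (negbTE uy).
  by have [/setD1P[_ ->]] := V1A u uV1 guA.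
Qed.

(** * Double counting of edges *)

Definition nbrs (Y : {set T}) v := \sum_(u in Y) (e v u : nat).

Lemma card_nbrs (Y : {set T}) v : #|[set u in Y | e v u]| = nbrs Y v.
Proof.
rewrite -sum1_card /nbrs [RHS]big_mkcond [LHS]big_mkcond /=.
by apply: eq_bigr => u _; rewrite inE; case: (u \in Y); case: (e v u).
Qed.

Lemma nbrs_sub (Y Y' : {set T}) v : Y \subset Y' -> nbrs Y v <= nbrs Y' v.
Proof.
move=> sub; rewrite -!card_nbrs; apply/subset_leq_card/subsetP => u.
by rewrite !inE => /andP[/(subsetP sub) -> ->].
Qed.

Lemma nbrs_exchange (X Y : {set T}) : \sum_(u in X) nbrs Y u = \sum_(v in Y) nbrs X v.
Proof.
rewrite /nbrs exchange_big /=; apply: eq_bigr => v _.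
by apply: eq_bigr => u _; rewrite e_sym.
Qed.

Lemma free_nbrs V f v i : free V f v i = (nbrs (color_class V f i) v == 0).
Proof.
rewrite -card_nbrs cards_eq0; apply/freeP/eqP => [fr|/setP s0 u uV fu].
  apply/setP => u; rewrite !inE; apply/negbTE/negP => /andP[/andP[uV /eqP fu]].
  by rewrite fr.
by move: (s0 u); rewrite !inE uV fu eqxx.
Qed.

Lemma sum_classes V f (A : {set C}) (F : T -> nat) :
  \sum_(v in [set u in V | f u \in A]) F v
  = \sum_(i in A) \sum_(v in color_class V f i) F v.
Proof.
rewrite (partition_big f (mem A)) /= => [|v]; last by rewrite inE => /andP[].
apply: eq_bigr => i iA; apply: eq_bigl => v; rewrite !inE.
by case: eqP => [->|]; rewrite ?iA ?andbF ?andbT.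
Qed.

Lemma card_classes V f (A : {set C}) :
  #|[set u in V | f u \in A]| = \sum_(i in A) #|color_class V f i|.
Proof.
by rewrite -sum1_card sum_classes; apply: eq_bigr => i _; rewrite sum1_card.
Qed.

Lemma sum_all_classes V f (F : T -> nat) :
  \sum_(v in V) F v = \sum_i \sum_(v in color_class V f i) F v.
Proof.
rewrite (partition_big f predT) //=; apply: eq_bigr => i _.
by apply: eq_bigl => v; rewrite inE.
Qed.

Lemma not_movable_cut V f i j : ~~ movable V f i j ->
  #|color_class V f i| <= \sum_(u in color_class V f i) nbrs (color_class V f j) u.
Proof.
move=> nmv; rewrite -sum1_card; apply: leq_sum => u; rewrite inE => /andP[uV /eqP fu].
rewrite lt0n -free_nbrs; apply: contraNN nmv => fr.
by apply/movableP; exists u.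
Qed.

Lemma card_uneven V f q : (forall i, #|color_class V f i| <= q.+1) ->
  (exists i, #|color_class V f i| = q) -> #|V| < #|C| * q.+1.
Proof.
move=> le [i0 i0q]; rewrite -sum1_card (sum_all_classes V f).
under eq_bigr => i _ do rewrite sum1_card.
rewrite (bigD1 i0) //= i0q (cardD1 i0 C) mulSn.
rewrite addSn ltnS leq_add2l -sum_nat_const.
rewrite (eq_bigl (mem (predD1 C i0))); first exact: leq_sum.
by move=> i; rewrite !inE andbT.
Qed.

(* The density bound [2 d] on average degrees, with [d] replaced by [100 r / 621]. *)
Definition sparse_set (S : {set T}) :=
  621 * \sum_(u in S) nbrs S u <= 200 * #|C| * #|S|.

(** A class in [Z] and one outside span at least [q.+1] edges: count from a class of that size not
    movable to the other. There are fewer than [#|C| * q.+1] vertices, so sparsity bounds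
    [#|Z| * (#|C| - #|Z|)] as [gap_arith] requires. *)
Lemma separated_classes_gap V f q (Z : {set C}) : sparse_set V ->
    (forall i, #|color_class V f i| <= q.+1) ->
    (exists i, #|color_class V f i| = q) ->
    (forall i, i \in Z -> #|color_class V f i| = q.+1) ->
    (forall i j, i \in Z -> j \notin Z -> ~~ movable V f i j \/
       #|color_class V f j| = q.+1 /\ ~~ movable V f j i) ->
  (500 * #|Z| < 101 * #|C|) || (399 * #|C| < 500 * #|Z|).
Proof.
move=> sparseV le small Zcard sep.
pose cut i j := \sum_(u in color_class V f i) nbrs (color_class V f j) u.
have cutC i j : cut i j = cut j i by apply: nbrs_exchange.
have cut_ge i j : i \in Z -> j \notin Z -> q.+1 <= cut i j.
  move=> iZ jZ; have [/not_movable_cut|[jq /not_movable_cut]] := sep i j iZ jZ.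
    by rewrite Zcard.
  by rewrite jq cutC.
have degsum : \sum_(u in V) nbrs V u = \sum_i \sum_j cut i j.
  rewrite (sum_all_classes V f); apply: eq_bigr => i _.
  rewrite /cut [RHS]exchange_big /=; apply: eq_bigr => u _.
  exact: sum_all_classes.
have cardZC : #|~: Z| = #|C| - #|Z| by rewrite -(cardsC Z) addKn.
(* The factor 2 arises because each pair of classes occurs in both orders. *)
have lower : 2 * (#|Z| * (#|C| - #|Z|) * q.+1) <= \sum_i \sum_j cut i j.
  rewrite (bigID (mem Z)) /= mul2n -addnn; apply: leq_add.
    rewrite -mulnA -sum_nat_const; apply: leq_sum => i iZ.
    rewrite -cardZC -sum_nat_const [leqRHS](bigID (mem (~: Z))) /=.
    apply: leq_trans (leq_addr _ _); apply: leq_sum => j; rewrite inE.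
    exact: cut_ge.
  rewrite [_ * (_ - _)]mulnC -mulnA -cardZC -sum_nat_const.
  rewrite [leqRHS](eq_bigl (mem (~: Z))) => [|i]; last by rewrite !inE.
  apply: leq_sum => i; rewrite inE => iZ.
  rewrite -sum_nat_const [leqRHS](bigID (mem Z)) /=.
  apply: leq_trans (leq_addr _ _); apply: leq_sum => j jZ.
  by rewrite cutC; apply: cut_ge.
have ltV := card_uneven le small.
have Cgt0 : 0 < #|C| by case: small => i _; apply/card_gt0P; exists i.
have Zle : #|Z| <= #|C| by apply: max_card.
move: sparseV; rewrite /sparse_set degsum => sparseV.
have main : 621 * (#|Z| * (#|C| - #|Z|)) < 100 * (#|C| * #|C|).
  have ltCV : #|C| * #|V| < #|C| * (#|C| * q.+1) by rewrite ltn_pmul2l.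
  rewrite -(ltn_pmul2r (ltn0Sn q)); move: sparseV lower ltCV.
  move: (#|Z| * _) (\sum_i _) => X Y; rewrite -!mulnA.
  by move: (X * _) (#|C| * #|V|) (#|C| * (_ * _)) => a b c; lia.
by move: main; rewrite -{2 3 4 5}(subnKC Zle); apply: gap_arith.
Qed.

Definition solo (X Y : {set T}) z := [set y in Y | e y z & nbrs X y == 1].

(** A vertex with several neighbours in [X] is counted at least twice by [nbrs]; a vertex of [Y]
    with just one is counted once there and once by [solo]. *)
Lemma solo_count (X Y Y' : {set T}) : Y \subset Y' ->
    (forall y, y \in Y' -> 0 < nbrs X y) ->
  #|Y'| + #|Y| <= \sum_(z in X) (#|solo X Y z| + nbrs Y' z).
Proof.
move=> sub pos; rewrite big_split /= nbrs_exchange addnC.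
have -> : \sum_(z in X) #|solo X Y z| = \sum_(y in Y) (nbrs X y == 1).
  under eq_bigr => z _ do rewrite -sum1_card big_mkcond /=.
  rewrite exchange_big /= [RHS]big_mkcond /=; apply: eq_bigr => y _.
  case: (boolP (y \in Y)) => yY; last first.
    by rewrite big1 // => z _; rewrite inE (negbTE yY).
  case: eqP => [n1|n1]; last by rewrite big1 // => z _; rewrite inE (introF eqP n1) !andbF.
  rewrite -[RHS]n1 /nbrs; apply: eq_bigr => z _; rewrite inE yY n1 eqxx andbT.
  by case: (e y z).
have card_in (Z : {set T}) : Z \subset Y' -> #|Z| = \sum_(y in Y') (y \in Z).
  move=> /subsetP ZY; rewrite -sum1_card big_mkcond [RHS]big_mkcond /=.
  apply: eq_bigr => y _; case: (boolP (y \in Z)) => [/ZY ->|] //.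
  by case: (y \in Y').
rewrite (card_in Y sub) (card_in Y' (subxx _)) -big_split /=.
have -> : \sum_(y in Y) (nbrs X y == 1) = \sum_(y in Y') ((y \in Y) && (nbrs X y == 1)).
  rewrite big_mkcond [RHS]big_mkcond /=; apply: eq_bigr => y _.
  case: (boolP (y \in Y)) => [/(subsetP sub) ->|] //=.
  by case: (y \in Y').
rewrite -big_split /=; apply: leq_sum => y yY'; rewrite yY'.
by have := pos y yY'; case: (y \in Y) => /=; case: (nbrs X y) => [|[|n]].
Qed.

(** Argue class by class, with [n] neighbours of [z] in the class. If [n = 1], the vertices of [S]
    there are all counted on the right; if [n > 1], they number at most [n], and
    [n + 2 <= 2 * n]. *)
Lemma unique_count V f (P : {set C}) z (S : {set T}) :
    S \subset [set u in V | f u \in P] -> (forall y, y \in S -> e z y) ->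
    (forall i, i \in P -> 0 < nbrs (color_class V f i) z) ->
  #|S| + 2 * #|P| <= #|[set y in S | nbrs (color_class V f (f y)) z == 1]|
                     + 2 * nbrs [set u in V | f u \in P] z.
Proof.
move=> /subsetP subS adj pos; set Q := [set y in S | _].
have cardP (Z : {set T}) : Z \subset S -> #|Z| = \sum_(i in P) #|[set y in Z | f y == i]|.
  move=> /subsetP ZS; rewrite -card_classes; apply: eq_card => y; rewrite inE.
  by case: (boolP (y \in Z)) => //= /ZS /subS; rewrite inE => /andP[_ ->].
have QS : Q \subset S by apply/subsetP => y; rewrite inE => /andP[].
rewrite (cardP S (subxx _)) (cardP Q QS) /nbrs sum_classes -/(nbrs _ _).
rewrite mulnC -sum_nat_const big_distrr /= -!big_split /=; apply: leq_sum => i iP.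
have := pos i iP; rewrite -/(nbrs (color_class V f i) z); set n := nbrs _ z => n0.
have Sn : #|[set y in S | f y == i]| <= n.
  rewrite /n -card_nbrs; apply/subset_leq_card/subsetP => y; rewrite !inE.
  move=> /andP[yS /eqP fy]; rewrite adj // fy eqxx andbT andbT.
  by move: (subS y yS); rewrite inE => /andP[].
case: (eqVneq n 1) => [n1|n1]; last by lia.
have -> : [set y in Q | f y == i] = [set y in S | f y == i]; last by lia.
apply/setP => y; rewrite !inE; case: (eqVneq (f y) i) => [->|]; rewrite ?andbF //.
by rewrite -/n n1 eqxx !andbT.
Qed.

Lemma dominating_clique_sum (Q S : {set T}) : Q \subset S ->
    (forall u v, u \in Q -> v \in S -> u != v -> e u v) ->
  #|Q| * #|S|.-1 + (#|S| - #|Q|) * #|Q| <= \sum_(u in S) nbrs S u.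
Proof.
move=> QS adj; rewrite (bigID (mem Q)) /=.
have card2 : #|S :\: Q| = #|S| - #|Q|.
  by rewrite -(cardsID Q S) (setIidPr QS) addKn.
apply: leq_add.
  rewrite -sum_nat_const [leqRHS](eq_bigl (mem Q)) => [|u]; last first.
    by rewrite /= andbC; case: (boolP (u \in Q)) => // /(subsetP QS) ->.
  apply: leq_sum => u uQ; have uS := subsetP QS u uQ.
  have -> : #|S|.-1 = #|S :\ u| by rewrite (cardsD1 u S) uS.
  rewrite -card_nbrs; apply/subset_leq_card/subsetP => v; rewrite !inE.
  by move=> /andP[vu vS]; rewrite vS adj // eq_sym.
rewrite -card2 -sum_nat_const [leqRHS](eq_bigl (mem (S :\: Q))) => [|u]; last first.
  by rewrite !inE andbC.
apply: leq_sum => u; rewrite !inE => /andP[uQ uS].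
rewrite -card_nbrs; apply/subset_leq_card/subsetP => v vQ; rewrite !inE.
rewrite (subsetP QS) // e_sym adj //; by apply: contraNneq uQ => <-.
Qed.

Lemma nbrs1_inj (Y : {set T}) v u w : nbrs Y v = 1 ->
  u \in Y -> w \in Y -> e v u -> e v w -> u = w.
Proof.
rewrite -card_nbrs => /eqP/cards1P[y yE] uY wY evu evw.
have : u \in [set a in Y | e v a] by rewrite inE uY.
have : w \in [set a in Y | e v a] by rewrite inE wY.
by rewrite yE !inE => /eqP -> /eqP ->.
Qed.

Lemma nbrs_classes_ge V f (A : {set C}) v :
    (forall i, i \in A -> 0 < nbrs (color_class V f i) v) ->
  #|A| <= nbrs [set u in V | f u \in A] v.
Proof.
move=> pos; rewrite /nbrs sum_classes -sum1_card; apply: leq_sum => i iA.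
exact: pos.
Qed.

(** * Accessible classes and the effect of a rotation *)

Definition balanced V f q := forall i, q <= #|color_class V f i| <= q.+1.

Definition small V f q := [set i | #|color_class V f i| == q].

Definition accessible V f q := coreach (movable V f) (small V f q).

Lemma extend_balanced V f q h j i : proper V f -> balanced V f q -> h \notin V ->
    free V f h j -> connect (movable V f) j i -> i \in small V f q ->
  exists2 g, proper (h |: V) g & balanced (h |: V) g q.
Proof.
move=> pf bal hV fr cji; rewrite inE => /eqP iq.
have [g pg cg] := shift_into pf hV fr cji; exists g => // k; rewrite cg.
by have := bal k; case: eqP => [->|_]; rewrite ?iq; lia.
Qed.

(** These moves survive a rotation, which inside [A] alters only the class [W] of [z]. *)
Definition avoiding V f (A : {set C}) W :=
  [rel a b | [&& a \in A :\ W, b \in A :\ W & movable V f a b]].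

Section Rotation.
Variables (V V1 : {set T}) (f g : T -> C) (A : {set C}) (z h y : T).
Hypotheses (V1E : V1 = h |: V :\ z) (gy : g y = f z)
  (gA : forall u, u \in V :\ z -> f u \in A -> g u = f u)
  (Ag : forall u, u \in V1 -> u != y -> g u \in A -> u \in V :\ z /\ f u = g u).

(** Only [y] can enter a class of [A], and it enters that of [z]; the others gain no vertex. *)
Lemma rotated_class u k : k \in A :\ f z -> u \in V1 -> g u = k ->
  u \in V /\ f u = k.
Proof.
move=> /setD1P[kz kA] uV1 gu; have uy : u != y.
  by apply: contraNneq kz => uy; rewrite -gu uy gy.
by have [|/setD1P[_ uV] ->] := Ag uV1 uy; rewrite ?gu.
Qed.

Lemma rotated_free v k : k \in A :\ f z -> free V f v k -> free V1 g v k.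
Proof.
move=> kA /freeP fr; apply/freeP => u uV1 gu.
by have [uV fu] := rotated_class kA uV1 gu; apply: fr.
Qed.

Lemma rotated_movable v a b : v \in V :\ z -> f v = a -> a \in A ->
  b \in A :\ f z -> free V f v b -> movable V1 g a b.
Proof.
move=> vV fv aA bA fr; apply/movableP; exists v; last exact: rotated_free.
by rewrite V1E in_setU1 vV orbT gA // fv.
Qed.

Lemma rotated_connect a b :
  connect (avoiding V f A (f z)) a b -> connect (movable V1 g) a b.
Proof.
apply: connect_sub => i j /= /and3P[iA jA /movableP[v [vV fv] fr]].
apply: connect1; have [iz iA'] := setD1P iA.
apply: rotated_movable fr => //; rewrite in_setD1 vV andbT.
by apply: contraNneq iz => vz; rewrite -fv vz.
Qed.

End Rotation.

Section Improvement.
Variables (V : {set T}) (f : T -> C) (q : nat) (W : C).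
Hypotheses (pf : proper V f) (bal : balanced V f q).
Let A := accessible V f q.

Lemma accessibleC_closed i k : i \notin A -> movable V f i k -> k \notin A.
Proof. by move=> iA mv; apply: coreachC_connect iA (connect1 mv). Qed.

Lemma accessibleC_card i : i \notin A -> #|color_class V f i| = q.+1.
Proof.
move=> iA; have : i \notin small V f q.
  by apply: contraNN iA; apply: (subsetP (sub_coreach _ _)).
by rewrite inE; have := bal i; lia.
Qed.

Hypothesis terminal : forall i, i \in A :\ W ->
  exists2 j, j \in small V f q :\ W & connect (avoiding V f A W) i j.

(** A rotation with [h = x] leaves [z] as the one uncoloured vertex. It enters [k], from where moves
    avoiding [W] shift the surplus to a small class. *)
Lemma kick_out z x y j k : z \in V -> f z = W -> W \in A -> y \in V -> f y \notin A ->
    (forall u, u \in V -> f u = W -> e y u -> u = z) ->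
    x \notin V -> j \notin A -> free V f x j -> connect (movable V f) j (f y) ->
    k \in A :\ W -> free V f z k ->
  exists2 g, proper (x |: V) g & balanced (x |: V) g q.
Proof.
move=> zV fz WA yV yA solo_y xV jA /freeP frx cjy kA frz.
have xVz : x \notin V :\ z by rewrite in_setD1 (negbTE xV) andbF.
have only u : u \in V -> f u = j -> e x u -> u = y.
  by move=> uV fu; rewrite frx.
rewrite -fz in WA solo_y; have [g [pg cg gy gA Ag]] :=
  rotate pf accessibleC_closed zV WA yV yA solo_y xVz jA only cjy.
rewrite -fz in kA; have [s ss cks] : exists2 s, s \in small V f q :\ f z &
    connect (avoiding V f A (f z)) k s by rewrite fz; apply: terminal; rewrite -fz.
have zx : z != x by apply: contraNneq xV => <-.
have zV1 : z \notin x |: V :\ z by rewrite !inE eqxx (negbTE zx).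
have eqV : z |: (x |: V :\ z) = x |: V.
  apply/setP => u; rewrite !inE; case: (eqVneq u z) => [->|//].
  by rewrite zV orbT.
rewrite -eqV; apply: (@extend_balanced _ g q z k s) => //.
- by move=> i; rewrite cg.
- exact: (rotated_free gy Ag kA frz).
- exact: (rotated_connect erefl gy gA Ag cks).
- by move: ss; rewrite !inE cg => /andP[].
Qed.

(** A rotation with [h = z] sends [z] to class [j] and [y] to [W]. The classes of [A] stay
    accessible, and [y'], not adjacent to [y], can now move to [W], so its class joins them. *)
Lemma enlarge_accessible z y y' j : z \in V -> f z = W -> W \in A ->
    W \in small V f q \/ (exists2 k, k \in A :\ W & movable V f W k) ->
    (forall k, k \in A :\ W -> ~~ free V f z k) ->
    y \in V -> f y \notin A -> (forall u, u \in V -> f u = W -> e y u -> u = z) ->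
    j \notin A -> (forall u, u \in V -> f u = j -> e z u -> u = y) ->
    connect (movable V f) j (f y) ->
    y' \in V -> f y' \notin A -> (forall u, u \in V -> f u = W -> e y' u -> u = z) ->
    y' != y -> ~~ e y' y ->
  exists g, [/\ proper V g, balanced V g q & #|A| < #|accessible V g q|].
Proof.
move=> zV fz WA Wout nfr yV yA solo_y jA only cjy y'V y'A solo_y' y'y nadj.
have zVz : z \notin V :\ z by rewrite !inE eqxx.
have yz : y != z by apply: contraNneq yA => ->; rewrite fz.
have y'z : y' != z by apply: contraNneq y'A => ->; rewrite fz.
rewrite -fz in WA solo_y solo_y'; have [g [pg cg gy gA Ag]] :=
  rotate pf accessibleC_closed zV WA yV yA solo_y zVz jA only cjy.
have eqV : V = z |: V :\ z by rewrite setD1K.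
rewrite -eqV in pg cg Ag.
have smallE : small V g q = small V f q by apply/setP => i; rewrite !inE cg.
have accW i : i \in A :\ W -> i \in accessible V g q.
  move=> iA; have [s /setD1P[_ ss]] := terminal iA; rewrite -fz => cis.
  apply/coreachP; exists s; first by rewrite smallE.
  exact: (rotated_connect eqV gy gA Ag cis).
have acc_W : W \in accessible V g q.
  case: Wout => [Ws|[k kA /movableP[w [wV fw] frw]]].
    by apply: (subsetP (sub_coreach _ _)); rewrite smallE.
  apply: coreach_step (accW k kA).
  (* By [nfr] the vertex giving [W] its way out is not [z], so it is still in [W]. *)
  have wz : w \in V :\ z.
    by rewrite in_setD1 wV andbT; apply: contraTneq frw => ->; apply: nfr.
  by apply: (rotated_movable eqV gy gA Ag wz fw) => //; rewrite ?fz // -fz.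
have gy'A : g y' \notin A.
  apply/negP => gy'A; have [_ fy'] := Ag y' y'V y'y gy'A.
  by rewrite fy' gy'A in y'A.
exists g; split=> //; first by move=> i; rewrite cg.
have : g y' |: A \subset accessible V g q.
  rewrite subUset sub1set; apply/andP; split; last first.
    apply/subsetP => i iA; case: (eqVneq i W) => [->//|iW].
    by apply: accW; rewrite in_setD1 iW.
  apply: coreach_step acc_W; apply/movableP; exists y' => //.
  apply/freeP => u uV gu; case: (eqVneq u y) => [->|uy]; first exact: negbTE.
  have [|/setD1P[uz _] fu] := Ag u uV uy; first by rewrite gu -fz.
  apply/negbTE/negP => ey'u; move: uz; rewrite (solo_y' u) ?eqxx //.
  by rewrite fu gu fz.
by move=> /subset_leq_card; rewrite cardsU1 gy'A.
Qed.

End Improvement.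

(** This is averaging; when [c] holds, [X] has at most [q] elements, which lifts the average above
    [n]. *)
Lemma exists_heavy (X : {set T}) (F : T -> nat) q n (c : bool) : #|X| + c <= q.+1 ->
    0 < n -> n * q.+1 <= \sum_(z in X) F z -> exists2 z, z \in X & n + c <= F z.
Proof.
move=> Xc n0 sumF; apply/exists_inP; apply: contraT.
rewrite negb_exists_in => /forall_inP light; exfalso.
have : \sum_(z in X) F z <= #|X| * (n + c).-1.
  rewrite -sum_nat_const; apply: leq_sum => z zX; have := light z zX.
  by clear; case: n c => [|n] []; lia.
move: sumF Xc n0; move: (\sum_(z in X) _) #|X| => s k; clear.
by case: c; case: n => [|n] //=; nia.
Qed.

(** * Extending a colouring one vertex at a time *)

Hypotheses (sparse : forall S, sparse_set S) (deg_le : forall v, nbrs setT v <= #|C|).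

Lemma improve V f q x : proper V f -> balanced V f q -> small V f q != set0 ->
    x \notin V -> 621 * nbrs V x <= 200 * #|C| ->
  (exists2 g, proper (x |: V) g & balanced (x |: V) g q) \/
  (exists g, [/\ proper V g, balanced V g q &
     #|accessible V f q| < #|accessible V g q|]).
Proof.
move=> pf bal s0 xV degx; set r := #|C|.
have closed := @accessibleC_closed V f q; have cardB := accessibleC_card bal.
have sA : small V f q \subset accessible V f q := sub_coreach _ _.
have accP i : i \in accessible V f q -> exists2 k, k \in small V f q &
  connect (movable V f) i k by move/coreachP.
have closedB i j : i \in ~: accessible V f q -> connect (movable V f) i j ->
  j \in ~: accessible V f q by rewrite !in_setC; apply: coreachC_connect.
have [W [WA Wout terminal]] := exists_terminal (movable V f) s0.
have [A AE] : exists A, A = accessible V f q by exists (accessible V f q).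
rewrite -/(accessible V f q) -AE in closed cardB sA accP closedB WA Wout terminal *.
have r0 : 0 < r.
  by have /set0Pn[i _] := s0; apply/card_gt0P; exists i.
case: (boolP [exists i in A, free V f x i]) => [/exists_inP[i iA fri]|].
  by left; have [k ks cik] := accP i iA; apply: extend_balanced fri cik ks.
rewrite negb_exists_in => /forall_inP xA.
have sub_classes (Z : {set C}) : [set u in V | f u \in Z] \subset V.
  by apply/subsetP => u; rewrite inE => /andP[].
have Aa : #|A| <= nbrs V x.
  apply: leq_trans (nbrs_sub x (sub_classes A)); apply: nbrs_classes_ge => i iA.
  by rewrite lt0n -free_nbrs xA.
have BA : #|A| + #|~: A| = r := cardsC A.
have some_small : exists i, #|color_class V f i| = q.
  by have /set0Pn[i] := s0; rewrite inE => /eqP iq; exists i.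
have le_q i : #|color_class V f i| <= q.+1 by case/andP: (bal i).
have gap (Z : {set C}) : Z \subset ~: A ->
    (forall i j, i \in Z -> j \notin Z -> movable V f i j -> movable V f j i -> False) ->
    (500 * #|Z| < 101 * r) || (399 * r < 500 * #|Z|).
  move=> /subsetP ZB sep; apply: (@separated_classes_gap V f q) => //.
    by move=> i /ZB; rewrite in_setC; apply: cardB.
  move=> i j iZ jZ; case: (boolP (movable V f i j)) => mv; last by left.
  right; have iB : i \notin A by have := ZB i iZ; rewrite in_setC.
  split; first by apply: cardB; apply: closed iB mv.
  by apply/negP; apply: sep mv.
(* By [Aa], [A] has at most [200 / 621] of all classes, which excludes the first alternative. *)
have largeB : 399 * r < 500 * #|~: A|.
  have /orP[|//] : (500 * #|~: A| < 101 * r) || (399 * r < 500 * #|~: A|).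
    apply: gap => // i j iB; rewrite in_setC negbK => jA mv.
    by have := closedB i j iB (connect1 mv); rewrite in_setC jA.
  by lia.
have [P [PB largeP connP _]] := exists_large_component closedB gap largeB.
have PA i : i \in P -> i \notin A by move=> /(subsetP PB); rewrite in_setC.
have pb : #|P| <= #|~: A| by apply: subset_leq_card.
(* The neighbours of [x] are too few to meet every class of [P], as [200 / 621 < 399 / 500]. *)
have [jx jxP frx] : exists2 j, j \in P & free V f x j.
  apply/exists_inP; apply: contraT; rewrite negb_exists_in => /forall_inP xP.
  have : #|P| <= nbrs V x.
    apply: leq_trans (nbrs_sub x (sub_classes P)); apply: nbrs_classes_ge => i iP.
    by rewrite lt0n -free_nbrs xP.
  by lia.
set X := color_class V f W.
set VP := [set u in V | f u \in P]; set VB := [set u in V | f u \in ~: A].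
have VPB : VP \subset VB.
  by apply/subsetP => u; rewrite !in_set => /andP[-> /PA ->].
have XW z : z \in X -> z \in V /\ f z = W by rewrite inE => /andP[zV /eqP].
have soloP z y : y \in solo X VP z -> [/\ y \in V, f y \in P, f y \notin A, e y z
    & z \in X -> forall u, u \in V -> f u = W -> e y u -> u = z].
  rewrite 2!inE => /and3P[/andP[yV fyP] eyz /eqP n1]; split=> //; first exact: PA.
  by move=> zX u uV fu eyu; apply: (nbrs1_inj n1) => //; rewrite inE uV fu eqxx.
case: (boolP [exists z in X, (solo X VP z != set0) &&
    [exists k in A :\ W, free V f z k]]).
  move=> /exists_inP[z zX /andP[/set0Pn[y /soloP[yV fyP fyA eyz solo_y]]]].
  move=> /exists_inP[k kA frz]; left; have [zV fz] := XW z zX; subst A.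
  apply: (kick_out pf bal terminal zV fz WA yV fyA _ xV (PA _ jxP) frx) => //.
  - exact: solo_y.
  - exact: connP.
  - exact: kA.
  - exact: frz.
rewrite negb_exists_in => /forall_inP stuck.
have posW y : y \in VB -> 0 < nbrs X y.
  rewrite !in_set => /andP[yV yA]; rewrite lt0n -free_nbrs; apply/negP => fr.
  have : movable V f (f y) W by apply/movableP; exists y.
  by move=> /(closed _ _ yA); rewrite WA.
have := solo_count VPB posW.
have cardV (Z : {set C}) : Z \subset ~: A -> #|[set u in V | f u \in Z]| = #|Z| * q.+1.
  move=> /subsetP ZB; rewrite card_classes -sum_nat_const; apply: eq_bigr => i /ZB.
  by rewrite in_setC; apply: cardB.
rewrite (cardV _ (subxx _)) (cardV _ PB) => count.
(* The bit [c] records that [W] has size [q] rather than [q.+1]. The gain it brings in [zc] makes up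
   for the case where [W] is the only class of [A]; see [Ac]. *)
have [c cE] : exists c, c = (W \in small V f q) by exists (W \in small V f q).
have [z zX zc] : exists2 z, z \in X & #|~: A| + #|P| + c <= #|solo X VP z| + nbrs VB z.
  apply: (@exists_heavy _ _ q); rewrite ?mulnDl //; last by clear -largeP; lia.
  rewrite cE inE -/X; have := le_q W; rewrite -/X; clear.
  by case: eqP => [->|]; lia.
have Ac : 1 < #|A| + c.
  rewrite cE; case: (boolP (W \in small V f q)) => Ws.
    by rewrite addn1 ltnS; apply/card_gt0P; exists W.
  have /set0Pn[i si] := s0; rewrite addn0; apply/card_gt1P; exists W, i.
  by rewrite WA (subsetP sA) //; split=> //; apply: contraNneq Ws => ->.
clear count cE; have [zV fz] := XW z zX.
have degz : nbrs V z <= r by apply: leq_trans (nbrs_sub z (subsetT V)) (deg_le z).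
have VBz : nbrs VB z <= nbrs V z := nbrs_sub z (sub_classes _).
have solo0 : solo X VP z != set0.
  by rewrite -card_gt0; move: zc VBz degz BA degx Aa largeP; clear; lia.
have hitA k : k \in A :\ W -> ~~ free V f z k.
  have := stuck z zX; rewrite solo0 /= negb_exists_in => /forall_inP; exact.
(* At least [#|A| - 1] of the at most [r] neighbours of [z] lie in other classes of [A]. With [zc]
   this gives at least [#|P| + c - 1] vertices in [solo X VP z]. *)
have dB : nbrs VB z + #|A| <= r.+1.
  have : #|A :\ W| <= nbrs [set u in V | f u \in A :\ W] z.
    by apply: nbrs_classes_ge => i iA; rewrite lt0n -free_nbrs hitA.
  have : nbrs [set u in V | f u \in A :\ W] z + nbrs VB z <= nbrs V z.
    rewrite -!card_nbrs -cardsUI (_ : _ :&: _ = set0) ?cards0 ?addn0.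
      apply/subset_leq_card/subsetP => u; rewrite in_setU !in_set.
      by case/orP=> /andP[/andP[-> _] ->].
    by apply/setP => u; rewrite in_setI !in_set; case: (f u \in A); rewrite ?andbF.
  by move: degz; rewrite (cardsD1 W A) WA; clear; lia.
set S := solo X VP z in zc solo0.
have Sin y : y \in S -> [/\ y \in V, f y \in P, f y \notin A, e y z
    & forall u, u \in V -> f u = W -> e y u -> u = z].
  by move=> /soloP[? ? ? ? H]; split=> //; apply: H.
(* [Q] gathers vertices of [S] whose place [z] can take. If [z] is free for a class outside [A]
   leading into [P], all of [S] qualifies. Otherwise [z] meets every class of [P], and [Q] consists
   of the vertices of [S] that are its only neighbour in their class. *)
have [Q [QS Qcard Qmove]] : exists Q : {set T}, [/\ Q \subset S, 3 * #|P| <= #|Q| + 2 * r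
    & forall y, y \in Q -> exists j, [/\ j \notin A,
        forall u, u \in V -> f u = j -> e z u -> u = y
        & connect (movable V f) j (f y)]].
  case: (boolP [exists j in ~: A, free V f z j &&
      [exists i in P, connect (movable V f) j i]]).
    move=> /exists_inP[j jB /andP[/freeP frj /exists_inP[i iP cji]]].
    exists S; split=> //; first by move: zc dB BA pb Ac; clear; lia.
    move=> y /Sin[_ fyP _ _ _]; exists j; split; first by move: jB; rewrite in_setC.
      by move=> u uV fu; rewrite frj.
    exact: connect_trans cji (connP _ _ iP fyP).
  rewrite negb_exists_in => /forall_inP noj.
  have hitP i : i \in P -> 0 < nbrs (color_class V f i) z.
    move=> iP; rewrite lt0n -free_nbrs; have := noj i (subsetP PB i iP).
    rewrite negb_and => /orP[//|/exists_inP []]; by exists i.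
  exists [set y in S | nbrs (color_class V f (f y)) z == 1]; split.
  - by apply/subsetP => y; rewrite inE => /andP[].
  - have SV : S \subset VP by apply/subsetP => y; rewrite inE => /andP[].
    have zS y : y \in S -> e z y by move=> /Sin[_ _ _ + _]; rewrite e_sym.
    have := unique_count SV zS hitP; rewrite -/VP; have := nbrs_sub z VPB.
    (* The additive constants are absorbed by [2 * #|A| + c >= 3], a consequence of [Ac]. *)
    by move: zc dB BA pb Ac; clear; lia.
  - move=> y; rewrite inE => /andP[/Sin[yV fyP fyA eyz _] /eqP n1].
    exists (f y); split=> // u uV fu ezu; apply: (nbrs1_inj n1) => //.
    + by rewrite inE uV fu eqxx.
    + by rewrite inE yV eqxx.
    + by rewrite e_sym.
case: (boolP [exists y in Q, [exists y' in S, (y' != y) && ~~ e y' y]]).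
  move=> /exists_inP[y yQ /exists_inP[y' y'S /andP[y'y nadj]]]; right.
  have [yV _ yA _ solo_y] := Sin y (subsetP QS y yQ).
  have [y'V _ y'A _ solo_y'] := Sin y' y'S.
  have [j [jA only cjy]] := Qmove y yQ; subst A.
  exact: (enlarge_accessible pf bal terminal zV fz WA Wout hitA yV yA solo_y
            jA only cjy y'V y'A solo_y' y'y nadj).
rewrite negb_exists_in => /forall_inP full; exfalso.
have adj u v : u \in Q -> v \in S -> u != v -> e u v.
  move=> uQ vS uv; have := full u uQ; rewrite negb_exists_in => /forall_inP/(_ v vS).
  by rewrite negb_and !negbK eq_sym (negbTE uv) e_sym.
have := dominating_clique_sum QS adj; have := sparse S; rewrite /sparse_set => h1 h2.
have A0 : 0 < #|A| by apply/card_gt0P; exists W.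
apply: (@clique_arith r #|P| #|S| #|Q|) => //.
- by move: BA pb A0; clear; lia.
- exact: subset_leq_card.
- by move: zc dB BA; clear; lia.
- by apply: leq_trans h1; rewrite leq_mul2l.
Qed.

Lemma extend_coloring V f q x : proper V f -> balanced V f q -> x \notin V ->
    621 * nbrs V x <= 200 * #|C| ->
  exists g q', proper (x |: V) g /\ balanced (x |: V) g q'.
Proof.
move=> pf bal xV degx.
(* Each failure to insert [x] enlarges the accessible set, so induct on the number of inaccessible
   classes. *)
have main p : forall f', proper V f' -> balanced V f' p -> small V f' p != set0 ->
    exists g q', proper (x |: V) g /\ balanced (x |: V) g q'.
  move=> f'; have [n] := ubnP (#|C| - #|accessible V f' p|).
  elim: n f' => // n IHn f' lt_n pf' bal' s0.
  have [[g pg bg]|[g [pg bg lt_acc]]] := improve pf' bal' s0 xV degx.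
    by exists g, p.
  apply: (IHn g) => //; first by have := max_card (accessible V g p); lia.
  have /set0Pn[i /coreachP[j js _]] : accessible V g p != set0.
    by rewrite -card_gt0; apply: leq_ltn_trans lt_acc.
  by apply/set0Pn; exists j.
(* If no class is small, all have size [q.+1], and at level [q.+1] all of them are small. *)
case: (eqVneq (small V f q) set0) => [s0|]; last exact: main.
have cq i : #|color_class V f i| = q.+1.
  have : i \notin small V f q by rewrite s0 inE.
  by rewrite inE; have := bal i; lia.
apply: (main q.+1 f) => // [i|]; first by rewrite cq leqnn leqnSn.
by apply/set0Pn; exists (f x); rewrite inE cq.
Qed.

Lemma exists_balanced_coloring (i0 : C) (U : {set T}) :
  exists f q, proper U f /\ balanced U f q.
Proof.
have [n] := ubnP #|U|; elim: n U => // n IHn U lt_n.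
case: (set_0Vmem U) => [->|[u0 u0U]].
  exists (fun=> i0), 0; split=> [u v|i]; first by rewrite inE.
  by rewrite (_ : color_class _ _ _ = set0) ?cards0 //; apply/setP => u; rewrite !inE.
(* Sparsity of [U] bounds its average degree, hence the degree of some vertex. *)
have [x xU degx] : exists2 x, x \in U & 621 * nbrs U x <= 200 * #|C|.
  apply/exists_inP; apply: contraT; rewrite negb_exists_in => /forall_inP high.
  have := sparse U; rewrite /sparse_set leqNgt => /negP[].
  rewrite mulnC -sum_nat_const big_distrr /= (bigD1 u0) //= [ltnRHS](bigD1 u0) //=.
  rewrite -addSn leq_add //; first by rewrite ltnNge high.
  by apply: leq_sum => u /andP[uU _]; apply: ltnW; rewrite ltnNge high.
have [|f [q [pf bal]]] := IHn (U :\ x); first by have := cardsD1 x U; rewrite xU; lia.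
rewrite -(setD1K xU); apply: (extend_coloring pf bal); first by rewrite !inE eqxx.
apply: leq_trans degx; rewrite leq_mul2l /=; exact: nbrs_sub (subD1set _ _).
Qed.

End Recoloring.

(** * From edge counts to degree sums, and the theorem *)

Lemma degree_sum_edges (T : finType) (e : rel T) (S : {set T}) : irreflexive e ->
  \sum_(u in S) nbrs e S u <= 2 * #|[set f in edges e | f \subset S]|.
Proof.
move=> e_irr; set F := [set f in _ | _].
pose D := [set p : T * T | [&& p.1 \in S, p.2 \in S & e p.1 p.2]].
pose ends (p : T * T) := [set p.1; p.2].
have -> : \sum_(u in S) nbrs e S u = #|D|.
  rewrite /nbrs pair_big_dep /= -sum1_card [LHS]big_mkcond [RHS]big_mkcond /=.
  apply: eq_bigr => -[u v] _; rewrite inE /=.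
  by case: (u \in S); case: (v \in S); case: (e u v).
have endsF p : p \in D -> ends p \in F.
  rewrite !inE => /and3P[p1S p2S ep]; rewrite subUset !sub1set p1S p2S !andbT.
  by apply/imset2P; exists p.1 p.2; rewrite ?inE.
rewrite -sum1_card (partition_big ends (mem F)) //= mulnC -sum_nat_const.
apply: leq_sum => f _; rewrite sum1dep_card.
case: (set_0Vmem [set p in D | ends p == f]) => [s0|[[x y]]].
  by rewrite (_ : [set p | _] = set0) ?cards0 // -s0; apply/setP => p; rewrite !inE.
rewrite inE => /andP[_ /eqP fE]; rewrite -fE.
(* An edge comes from at most two ordered pairs. *)
have sub : [set p in D | ends p == ends (x, y)] \subset [set (x, y); (y, x)].
  apply/subsetP => -[u v]; rewrite !inE /= -!andbA => /and4P[_ _ euv /eqP E].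
  have inE' w : (w \in ends (u, v)) = (w \in ends (x, y)) by rewrite E.
  have := inE' u; have := inE' v; rewrite !inE !eqxx orbT /=.
  have uv : u != v by apply: contraTneq euv => ->; rewrite e_irr.
  move=> /esym/orP[] /eqP vE /esym/orP[] /eqP uE; move: uv; rewrite vE uE ?eqxx //.
    by rewrite orbT.
apply: leq_trans (subset_leq_card sub) _.
by rewrite cards2; case: (_ != _).
Qed.

Local Open Scope ring_scope.

Theorem theorem2 (R : realType) (d : R) (T : finType) (e : rel T) :
  simple_graph e ->
  0 < d ->
  (forall (S : {set T}) (F : {set {set T}}),
      is_subgraph e S F -> (#|F|%:R : R) <= d * (#|S|%:R)) ->
  (maxdeg e)%:R >= (621%:R / 100%:R) * d ->
  forall r : nat, (maxdeg e <= r)%N ->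
    exists c : T -> 'I_r, equitable_coloring e c.
Proof.
move=> [e_sym e_irr] d0 sparse maxd r le_r.
(* This trades the real [d] for the integer [r], so that sparsity becomes a statement about natural
   numbers. *)
have dr : 621%:R * d <= 100%:R * r%:R.
  have : (maxdeg e)%:R <= r%:R :> R by rewrite ler_nat.
  by move: maxd; lra.
(* Positivity of [d] supplies the colour needed to start from the empty colouring. *)
have r0 : (0 < r)%N by rewrite -(ltr0n R); lra.
have deg_le v : (nbrs e setT v <= #|'I_r|)%N.
  rewrite -card_nbrs card_ord; apply: leq_trans le_r.
  rewrite (_ : [set u in [set: T] | e v u] = [set u | e v u]); last first.
    by apply/setP => u; rewrite !inE.
  exact: (leq_bigmax v).
have sparse_S (S : {set T}) : sparse_set 'I_r e S.
  rewrite /sparse_set card_ord; have := degree_sum_edges S e_irr.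
  set F := [set f in _ | _] => sumF.
  have FS : #|F|%:R <= d * #|S|%:R.
    apply: sparse; split; first by apply/subsetP => f; rewrite inE => /andP[].
    by move=> f; rewrite inE => /andP[].
  have : (621 * #|F| <= 100 * (r * #|S|))%N.
    rewrite -(ler_nat R) !natrM; have S0 : 0 <= #|S|%:R :> R by [].
    by move: (ler_wpM2r S0 dr); lra.
  by lia.
have [f [q [pf bal]]] :=
  exists_balanced_coloring e_sym e_irr sparse_S deg_le (Ordinal r0) setT.
exists f; split=> [x y exy|i j]; first by apply: pf.
have class k : #|[set x | f x == k]| = #|color_class setT f k|.
  by apply: eq_card => x; rewrite !inE.
by rewrite !class; have := bal i; have := bal j; lia.
Qed.
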